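(* Let $1 \leq \ell < n$ be integers. Then $\mathcal{O}_{\ell+1}^{\ell} \,|\, \mathcal{O}_n^{\ell}$; that is, the $\ell$-skeleton of the $n$-dimensional cross-polytope is the union of subcomplexes, each isomorphic to the $\ell$-skeleton of the $(\ell+1)$-dimensional cross-polytope, such that every $\ell$-face of $\mathcal{O}_n^\ell$ lies in exactly one of these subcomplexes.
   Context: $\mathcal{O}_n$ denotes the $n$-dimensional cross-polytope (whose 1-skeleton is the graph $K_{2n}$ minus a perfect matching). For a polytope $A$ and integer $k\ge 0$, $A^k$ denotes its $k$-skeleton (the polytopal complex of all faces of dimension at most $k$). For polytopal $\ell$-complexes $L$ and $K$, $L \,|\, K$ (''$L$ factors $K$'') means that $K$ and $L$ both have dimension $\ell$ and $K$ is the union of subcomplexes $L_1,\dots,L_r$, each isomorphic to $L$, such that every $\ell$-face of $K$ is contained in exactly one $L_i$. Note $\mathcal{O}_{\ell+1}^\ell$ is the boundary complex of $\mathcal{O}_{\ell+1}$. *)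

(* Defs.v *)
From HB Require Import structures.
From mathcomp Require Import all_boot all_order all_algebra.
From mathcomp Require Import boolp classical_sets functions cardinality reals.

Set Implicit Arguments.
Unset Strict Implicit.
Unset Printing Implicit Defensive.

Import Order.TTheory GRing.Theory Num.Theory.
Local Open Scope classical_set_scope.
Local Open Scope ring_scope.

Definition conv (R : realType) (n : nat) (s : seq 'rV[R]_n) : set 'rV[R]_n :=
  [set x | exists w : 'I_(size s) -> R,
    [/\ forall i, 0 <= w i, \sum_i w i = 1 & x = \sum_i w i *: s`_i]].

Definition is_polytope (R : realType) (n : nat) (P : set 'rV[R]_n) : Prop :=
  exists s : seq 'rV[R]_n, P = conv s.

Definition dotv (R : realType) (n : nat) (c x : 'rV[R]_n) : R :=
  \sum_(i < n) c 0 i * x 0 i.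

(* Faces are cut out by valid linear inequalities; c = 0 gives the improper
   faces set0 and P. *)
Definition is_face (R : realType) (n : nat) (F P : set 'rV[R]_n) : Prop :=
  exists (c : 'rV[R]_n) (b : R),
    (forall x, P x -> dotv c x <= b) /\ F = P `&` [set x | dotv c x = b].

Definition affinely_independent (R : realType) (n k : nat)
    (p : 'I_k -> 'rV[R]_n) : Prop :=
  forall a : 'I_k -> R,
    \sum_i a i = 0 -> \sum_i a i *: p i = 0 -> forall i, a i = 0.

(* Affine dimension: one less than the largest number of affinely independent
   points of A (at most n + 1 in R^n); the empty set has dimension -1. *)
Definition affdim (R : realType) (n : nat) (A : set 'rV[R]_n) : int :=
  (\max_(k < n.+2 | `[< exists p : 'I_k -> 'rV[R]_n,
      affinely_independent p /\ forall i, A (p i) >]) k)%:Z - 1.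

Definition polytopal_complex (R : realType) (n : nat)
    (K : set (set 'rV[R]_n)) : Prop :=
  [/\ finite_set K,
      K set0,
      forall P, K P -> is_polytope P,
      forall P F, K P -> is_face F P -> K F &
      forall P Q, K P -> K Q -> is_face (P `&` Q) P /\ is_face (P `&` Q) Q].

Definition subcomplex (R : realType) (n : nat)
    (L K : set (set 'rV[R]_n)) : Prop :=
  L `<=` K /\ polytopal_complex L.

Definition complex_dim (R : realType) (n : nat)
    (K : set (set 'rV[R]_n)) (l : nat) : Prop :=
  (exists2 F, K F & affdim F = l%:Z) /\ (forall F, K F -> affdim F <= l%:Z).

(* Combinatorial isomorphism of polytopal complexes, i.e. isomorphism of face
   posets; the ambient dimensions may differ. *)
Definition complex_isomorphic (R : realType) (m n : nat)
    (L : set (set 'rV[R]_m)) (K : set (set 'rV[R]_n)) : Prop :=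
  exists f : set 'rV[R]_m -> set 'rV[R]_n,
    set_bij L K f /\
    forall F G, L F -> L G -> (F `<=` G <-> f F `<=` f G).

Definition skeleton (R : realType) (n : nat) (P : set 'rV[R]_n) (k : nat) :
    set (set 'rV[R]_n) :=
  [set F | is_face F P /\ affdim F <= k%:Z].

Definition factors (R : realType) (m n l : nat)
    (L : set (set 'rV[R]_m)) (K : set (set 'rV[R]_n)) : Prop :=
  [/\ polytopal_complex L /\ polytopal_complex K,
      complex_dim L l /\ complex_dim K l &
      exists (r : nat) (L_ : 'I_r -> set (set 'rV[R]_n)),
        [/\ forall i, subcomplex (L_ i) K,
            forall i, complex_isomorphic (L_ i) L,
            K = \bigcup_i L_ i &
            forall F, K F -> affdim F = l%:Z -> exists! i, L_ i F]].

Definition cross_polytope (R : realType) (n : nat) : set 'rV[R]_n :=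
  conv ([seq delta_mx 0 i | i <- enum 'I_n] ++
        [seq - delta_mx 0 i | i <- enum 'I_n]).

Arguments cross_polytope R n : clear implicits.

(* Main.v *)
Require Import Defs.
From mathcomp Require Import all_boot all_order all_algebra.
From mathcomp Require Import boolp classical_sets functions cardinality reals.
From mathcomp Require Import ring lra.

(** The proper faces of the cross-polytope are indexed by sign vectors [s] in
    {-1, 0, 1}^n: [s] gives the simplex with vertices [s i *: e_i], [i] in the
    support of [s], of dimension #|supp s| - 1 (empty when [s = 0]). For each set
    [S] of l+1 coordinates, the faces supported in [S] form a copy of the boundary
    of the (l+1)-dimensional cross-polytope. An l-face has a support of l+1
    elements, so it lies in the copy attached to its support and in no other. *)

Set Implicit Arguments.
Unset Strict Implicit.
Unset Printing Implicit Defensive.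

Import Order.TTheory GRing.Theory Num.Theory.
Local Open Scope classical_set_scope.
Local Open Scope ring_scope.

Section CrossPolytopeFaces.
Context {R : realType}.

(** * Sums, convex combinations and affine dimension *)

Lemma eq_of_le_sum (I : finType) (f g : I -> R) :
  (forall i, f i <= g i) -> \sum_i g i <= \sum_i f i -> forall i, f i = g i.
Proof.
move=> fg gf i; apply/eqP; rewrite eq_sym -subr_eq0; apply/eqP.
have h0 : \sum_i (g i - f i) = 0.
  apply/eqP; rewrite eq_le sumr_ge0 ?andbT => [|j _]; last by rewrite subr_ge0.
  by rewrite sumrB subr_le0.
by apply: (psumr_eq0P _ h0) => // j _; rewrite subr_ge0.
Qed.

(** Lets weights be attached to labels, where [conv] attaches them to list positions. *)
Lemma conv_map n (T : Type) (r : seq T) (v : T -> 'rV[R]_n) (w : T -> R) :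
  (forall t, 0 <= w t) -> \sum_(t <- r) w t = 1 ->
  conv (map v r) (\sum_(t <- r) w t *: v t).
Proof.
case: r => [|t0 r'] w0; first by rewrite big_nil => /eqP; rewrite eq_sym oner_eq0.
set r := t0 :: r' => w1.
exists (fun i => w (nth t0 r i)); split=> //.
  by rewrite -w1 (big_nth t0) big_mkord size_map.
rewrite (big_nth t0) big_mkord size_map; apply: eq_bigr => i _.
by rewrite (nth_map t0).
Qed.

Lemma dotv_delta n (c : 'rV[R]_n) i : dotv c (delta_mx 0 i) = c 0 i.
Proof.
rewrite /dotv (bigD1 i) //= big1 => [|j ji].
  by rewrite mxE !eqxx mulr1 addr0.
by rewrite mxE (negPf ji) andbF mulr0.
Qed.

Lemma dotvZ n (c x : 'rV[R]_n) a : dotv c (a *: x) = a * dotv c x.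
Proof. by rewrite /dotv mulr_sumr; apply: eq_bigr => i _; rewrite mxE mulrCA. Qed.

Lemma dotv_sum n (c : 'rV[R]_n) (I : finType) (x : I -> 'rV[R]_n) :
  dotv c (\sum_k x k) = \sum_k dotv c (x k).
Proof.
rewrite /dotv exchange_big; apply: eq_bigr => i _.
by rewrite summxE mulr_sumr.
Qed.

Lemma affdim_ge n (A : set 'rV[R]_n) k (p : 'I_k -> 'rV[R]_n) :
  (k <= n.+1)%N -> affinely_independent p -> (forall i, A (p i)) ->
  k%:Z - 1 <= affdim A.
Proof.
move=> kn ap Ap; rewrite /affdim lerD2r lez_nat.
have kn' : (k < n.+2)%N by [].
apply: (leq_bigmax_cond (Ordinal kn')) => /=.
by apply/asboolP; exists p.
Qed.

Lemma affdim_le n (A : set 'rV[R]_n) (m : nat) :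
  (forall k (p : 'I_k -> 'rV[R]_n),
     affinely_independent p -> (forall i, A (p i)) -> (k <= m)%N) ->
  affdim A <= m%:Z - 1.
Proof.
move=> h; rewrite /affdim lerD2r lez_nat; apply/bigmax_leqP => k /asboolP [p [ap Ap]].
exact: h ap Ap.
Qed.

(** * The cross-polytope as the unit ball of the l1 norm *)

Definition l1norm n (x : 'rV[R]_n) : R := \sum_i `|x 0 i|.

Lemma l1normZ n a (x : 'rV[R]_n) : l1norm (a *: x) = `|a| * l1norm x.
Proof.
by rewrite /l1norm mulr_sumr; apply: eq_bigr => i _; rewrite mxE normrM.
Qed.

Lemma l1norm_delta n (i : 'I_n) : l1norm (delta_mx 0 i) = 1.
Proof.
rewrite /l1norm (bigD1 i) //= big1 => [|j ji].
  by rewrite mxE !eqxx normr1 addr0.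
by rewrite mxE (negPf ji) andbF normr0.
Qed.

Lemma l1norm_conv n (s : seq 'rV[R]_n) x :
  (forall y, y \in s -> l1norm y <= 1) -> conv s x -> l1norm x <= 1.
Proof.
move=> hs [w [w0 w1 ->]]; rewrite -w1.
apply: (@le_trans _ _ (\sum_k l1norm (w k *: s`_k))).
  rewrite /l1norm exchange_big; apply: ler_sum => i _.
  by rewrite summxE ler_norm_sum.
apply: ler_sum => k _; rewrite l1normZ ger0_norm // -[leRHS]mulr1.
by apply: ler_wpM2l => //; apply: hs; rewrite mem_nth.
Qed.

(** For n = 0 the hull of no points is empty while the ball is a point, hence the hypothesis. *)
Lemma cross_polytopeE n : (0 < n)%N ->
  cross_polytope R n = [set x | l1norm x <= 1].
Proof.
move=> n0; apply/seteqP; split=> x.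
  apply: l1norm_conv => y; rewrite mem_cat => /orP[] /mapP[i _ ->].
    by rewrite l1norm_delta.
  by rewrite -scaleN1r l1normZ l1norm_delta normrN normr1 mulr1.
rewrite /= => hx; rewrite /cross_polytope.
(* The slack 1 - [l1norm x] is shared equally by the 2n vertices; equal weights on opposite vertices
   cancel in the combination. *)
pose u := (1 - l1norm x) / (n%:R *+ 2).
have nR0 : n%:R != 0 :> R by rewrite pnatr_eq0 -lt0n.
have u0 : 0 <= u by rewrite divr_ge0 ?subr_ge0// mulrn_wge0.
pose v (t : bool * 'I_n) : 'rV[R]_n := (-1) ^+ t.1 *: delta_mx 0 t.2.
(* Up to the slack, e_i and -e_i get the positive and negative parts of x_i. *)
pose w (t : bool * 'I_n) : R := (`|x 0 t.2| + (-1) ^+ t.1 * x 0 t.2) / 2 + u.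
pose r := [seq (false, i) | i <- enum 'I_n] ++ [seq (true, i) | i <- enum 'I_n].
have sumr (V : nmodType) (f : bool * 'I_n -> V) :
    \sum_(t <- r) f t = \sum_i (f (false, i) + f (true, i)).
  by rewrite big_cat 2!big_map 2!big_enum big_split.
have -> : x = \sum_(t <- r) w t *: v t.
  rewrite sumr [LHS]row_sum_delta; apply: eq_bigr => i _.
  rewrite /v /w /= expr0 expr1 !scalerA -scalerDl; congr (_ *: _); by field.
rewrite (_ : _ ++ _ = map v r); last first.
  rewrite map_cat -!map_comp; congr (_ ++ _); apply: eq_map => i /=.
    by rewrite /v expr0 scale1r.
  by rewrite /v expr1 scaleN1r.
apply: conv_map => [t|].
  rewrite addr_ge0 // divr_ge0 //.
  rewrite -lerBlDl sub0r lerNl -mulNr.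
  by apply: le_trans (ler_norm _) _; rewrite normrM normrN normrX normrN1 expr1n mul1r.
rewrite sumr (eq_bigr (fun i => `|x 0 i| + u *+ 2)); last first.
  by move=> i _; rewrite /w /= expr0 expr1; field.
rewrite big_split sumr_const card_ord -/(l1norm x) /= /u -mulr_natr; field.
by rewrite nR0.
Qed.

(** The origin and the basis vectors are affinely independent. The bound keeps the improper face out
    of the l-skeleton when l < n. *)
Lemma affdim_cross_polytope n : (0 < n)%N -> n%:Z <= affdim (cross_polytope R n).
Proof.
move=> n0; rewrite cross_polytopeE //.
pose p (i : 'I_n.+1) : 'rV[R]_n :=
  if unlift ord0 i is Some j then delta_mx 0 j else 0.
have -> : n%:Z = n.+1%:Z - 1 by rewrite -addn1 PoszD addrK.
apply: (affdim_ge (p := p)) => // [a suma sumap|i]; last first.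
  rewrite /p /=; case: unliftP => [j|] _; first by rewrite l1norm_delta.
  by rewrite /l1norm big1 // => j _; rewrite mxE normr0.
have aj j : a (lift ord0 j) = 0.
  move: sumap; rewrite big_ord_recl {1}/p unlift_none scaler0 add0r.
  move/rowP/(_ j); rewrite summxE mxE (bigD1 j) //= big1 => [|k kj].
    by rewrite /p liftK !mxE !eqxx mulr1 addr0.
  by rewrite /p liftK !mxE eq_sym (negPf kj) andbF mulr0.
move=> i; case: (unliftP ord0 i) => [j ->|->] //.
by move: suma; rewrite big_ord_recl big1 ?addr0.
Qed.


(** * Sign vectors and the simplices they index *)

Definition sgnr (s : option bool) : R := if s is Some b then (-1) ^+ b else 0.

Lemma sgnr_inj : injective sgnr.
Proof.
by move=> [[]|] [[]|] //=; rewrite ?expr0 ?expr1 => h; exfalso; move: h; lra.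
Qed.

Lemma normr_sgnr s : `|sgnr s| = (s != None)%:R.
Proof. by case: s => [b|] /=; rewrite ?normr0 // normrX normrN1 expr1n. Qed.

Lemma sgnr_sqr s : sgnr s * sgnr s = (s != None)%:R.
Proof. by case: s => [[]|] /=; rewrite ?mulr0 // ?expr0 ?expr1 ?mulrNN mulr1. Qed.

Lemma sgnr_mul_le s (a : R) : sgnr s * a <= `|a|.
Proof.
apply: le_trans (ler_norm _) _; rewrite normrM normr_sgnr.
by case: (s != None); rewrite ?mul1r // mul0r.
Qed.

(** Links the sign condition in [sface] to the equality case of [sgnr_mul_le]; for [None] both say a
    = 0. *)
Lemma sgnr_mul_eq s (a : R) : a = sgnr s * `|a| <-> sgnr s * a = `|a|.
Proof.
split=> h.
  rewrite {1}h mulrA sgnr_sqr; case: s h => [b|] /= h; first by rewrite mul1r.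
  by rewrite mul0r h mul0r normr0.
rewrite -h mulrA sgnr_sqr; case: s h => [b|] /= h; first by rewrite mul1r.
by move/esym/eqP: h; rewrite !mul0r normr_eq0 => /eqP.
Qed.

Definition signvec n (s : 'I_n -> option bool) : 'rV[R]_n := \row_i sgnr (s i).

(** Signs are taken in [option bool] so that sign vectors form a finite type, which makes the
    complexes finite. *)
Definition supp n (s : {ffun 'I_n -> option bool}) : {set 'I_n} :=
  [set i | s i != None]%SET.

(* The everywhere [None] sign vector gives the empty face. *)
Definition sface n (s : {ffun 'I_n -> option bool}) : set 'rV[R]_n :=
  [set x | l1norm x = 1 /\ forall i, x 0 i = sgnr (s i) * `|x 0 i|].

(** In s . x <= [l1norm x] <= 1 the value 1 forces equality throughout, coordinate by coordinate.
    Thus [signvec s] exposes [sface s] as a face of the unit ball. *)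
Lemma sfaceP n (s : {ffun 'I_n -> option bool}) x :
  sface s x <-> l1norm x <= 1 /\ dotv (signvec s) x = 1.
Proof.
split=> [[x1 sx]|[x1 sx]].
  rewrite x1 lexx; split=> //; rewrite -x1; apply: eq_bigr => i _.
  by rewrite mxE; apply/sgnr_mul_eq.
have le i : sgnr (s i) * x 0 i <= `|x 0 i| by exact: sgnr_mul_le.
have sE : dotv (signvec s) x = \sum_i sgnr (s i) * x 0 i.
  by apply: eq_bigr => i _; rewrite mxE.
split=> [|i].
  by apply/le_anti; rewrite x1 /= -sx sE; exact: ler_sum.
apply/sgnr_mul_eq; move: i; apply: eq_of_le_sum => //.
by rewrite -sE sx.
Qed.

Lemma sface_vertex n (s : {ffun 'I_n -> option bool}) i :
  i \in supp s -> sface s (sgnr (s i) *: delta_mx 0 i).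
Proof.
rewrite inE => si; apply/sfaceP.
by rewrite l1normZ l1norm_delta dotvZ dotv_delta mxE sgnr_sqr normr_sgnr si mulr1.
Qed.

Lemma sface_out n (s : {ffun 'I_n -> option bool}) x i :
  sface s x -> i \notin supp s -> x 0 i = 0.
Proof. by move=> [_ ->]; rewrite inE negbK => /eqP ->; rewrite mul0r. Qed.

(** The vertex of s on axis i has a nonzero i-th coordinate, impossible in [sface t] if i is outside
    [supp t]. *)
Lemma sface_sub_supp n (s t : {ffun 'I_n -> option bool}) :
  sface s `<=` sface t -> supp s \subset supp t.
Proof.
move=> st; apply/fintype.subsetP => i si; apply/negPn/negP => ti.
have := sface_out (st _ (sface_vertex si)) ti.
move/eqP; rewrite !mxE !eqxx mulr1 -normr_eq0 normr_sgnr.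
by move: si; rewrite inE => ->; rewrite oner_eq0.
Qed.

Lemma sface0 n (s : {ffun 'I_n -> option bool}) : supp s = finset.set0 -> sface s = set0.
Proof.
move=> s0; apply/seteqP; split=> // x xs; have [+ _] := xs.
rewrite /l1norm big1 => [/esym/eqP|i _]; first by rewrite oner_eq0.
by rewrite (sface_out xs) ?normr0 // s0 inE.
Qed.

(** The |x_i| are barycentric coordinates with respect to the signed basis vectors; conversely, the
    conditions of [sfaceP] pass to convex combinations. *)
Lemma sface_polytope n (s : {ffun 'I_n -> option bool}) : is_polytope (sface s).
Proof.
exists [seq sgnr (s i) *: delta_mx 0 i | i <- enum (supp s)].
apply/seteqP; split=> x.
  move=> xs; have [x1 sx] := xs.
  have -> : x = \sum_(i <- enum (supp s)) `|x 0 i| *: (sgnr (s i) *: delta_mx 0 i).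
    rewrite big_enum /= [LHS]row_sum_delta [RHS]big_mkcond; apply: eq_bigr => i _.
    case: ifPn => si; first by rewrite scalerA mulrC -sx.
    by rewrite (sface_out xs si) scale0r.
  apply: conv_map => //; rewrite -x1 /l1norm big_enum /= big_mkcond.
  by apply: eq_bigr => i _; case: ifPn => // si; rewrite (sface_out xs si) normr0.
move=> cx; have vs y : y \in [seq sgnr (s i) *: delta_mx 0 i | i <- enum (supp s)] ->
    sface s y.
  by case/mapP => i; rewrite mem_enum => si ->; exact: sface_vertex.
apply/sfaceP; split.
  by apply: l1norm_conv cx => y /vs /sfaceP [].
case: cx => w [w0 w1 ->]; rewrite dotv_sum -w1; apply: eq_bigr => k _.
rewrite dotvZ; have /vs/sfaceP[_ ->] := mem_nth 0 (ltn_ord k).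
by rewrite mulr1.
Qed.

(** On the simplex, c . x averages the vertex values c_i s_i with weights |x_i|, so it reaches b
    exactly when only vertices of value b carry weight. *)
Lemma sface_faceP n (s : {ffun 'I_n -> option bool}) F : is_face F (sface s) ->
  exists2 t, supp t \subset supp s & F = sface t.
Proof.
case=> c [b [cb ->]].
(* Off the support of s both branches are [None], so the test is harmless even when b = 0. *)
pose t := [ffun i => if c 0 i * sgnr (s i) == b then s i else None].
exists t.
  by apply/fintype.subsetP => i; rewrite !inE ffunE; case: ifP.
have cvert i : i \in supp s -> c 0 i * sgnr (s i) <= b.
  by move=> /sface_vertex /cb; rewrite dotvZ dotv_delta mulrC.
have csum x : sface s x -> dotv c x = \sum_i c 0 i * sgnr (s i) * `|x 0 i|.
  by move=> [_ sx]; apply: eq_bigr => i _; rewrite {1}sx mulrA.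
have bsum x : sface s x -> b = \sum_i b * `|x 0 i|.
  by move=> [x1 _]; rewrite -mulr_sumr -/(l1norm x) x1 mulr1.
have xle x : sface s x -> forall i, c 0 i * sgnr (s i) * `|x 0 i| <= b * `|x 0 i|.
  move=> xs i; case: (boolP (i \in supp s)) => si.
    by rewrite ler_wpM2r // cvert.
  by rewrite (sface_out xs si) normr0 !mulr0.
apply/seteqP; split=> x /=.
  move=> [xs cx]; have [x1 sx] := xs; split=> // i.
  rewrite ffunE; case: ifPn => // /eqP ne.
  have : c 0 i * sgnr (s i) * `|x 0 i| = b * `|x 0 i|.
    move: i {ne}; apply: eq_of_le_sum; first exact: xle.
    by rewrite -csum // cx -bsum.
  rewrite mul0r; have [->//|x0] := eqVneq (x 0 i) 0.
  by move/mulIf => h; case: ne; apply: h; rewrite normr_eq0.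
move=> xt; have [x1 tx] := xt.
have xs : sface s x.
  split=> // i; move: (tx i); rewrite ffunE; case: ifP => // _.
  by rewrite mul0r => ->; rewrite normr0 mulr0.
split=> //; rewrite csum // [RHS](bsum x) //; apply: eq_bigr => i _.
move: (tx i); rewrite ffunE; case: eqP => [-> //|_].
by rewrite mul0r => ->; rewrite normr0 !mulr0.
Qed.

(** [signvec t] is at most 1 on the whole unit ball, so it cuts [sface t] out of any larger sign
    face. *)
Lemma sface_sub_face n (s t : {ffun 'I_n -> option bool}) :
  sface t `<=` sface s -> is_face (sface t) (sface s).
Proof.
move=> ts; exists (signvec t), 1; split=> [x [x1 _]|].
  by rewrite -x1; apply: ler_sum => i _; rewrite mxE sgnr_mul_le.
apply/seteqP; split=> x /=.
  by move=> xt; split; [exact: ts | case/sfaceP: xt].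
by move=> [[x1 _] tx]; apply/sfaceP; rewrite x1.
Qed.

(** A nonzero coordinate of a common point determines the sign there, so only the coordinates where
    s and t agree survive. *)
Lemma sface_capP n (s t : {ffun 'I_n -> option bool}) :
  exists2 u, supp u \subset supp s & sface s `&` sface t = sface u.
Proof.
exists [ffun i => if s i == t i then s i else None].
  by apply/fintype.subsetP => i; rewrite !inE ffunE; case: ifP.
apply/seteqP; split=> x /=.
  move=> [[x1 sx] [_ tx]]; split=> // i; rewrite ffunE; case: ifPn => // st.
  rewrite mul0r; have := sx i; rewrite {1}tx.
  have [->//|x0] := eqVneq (x 0 i) 0.
  have /mulIf inj : `|x 0 i| != 0 by rewrite normr_eq0.
  by move/inj/sgnr_inj => ts; rewrite ts eqxx in st.
move=> [x1 ux]; split; split=> // i; move: (ux i); rewrite ffunE.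
  by case: ifP => // _; rewrite mul0r => ->; rewrite normr0 mulr0.
by case: eqP => [->//|_]; rewrite mul0r => ->; rewrite normr0 mulr0.
Qed.

(** * Complexes of sign faces and the dimension of a sign face *)

Definition sfaces n (A : pred {set 'I_n}) : set (set 'rV[R]_n) :=
  [set sface s | s in [set s | A (supp s)]].

(** Passing to a face shrinks the support, so downward closure of [A] gives closure under faces.
    This serves both the skeleta (supports of bounded size) and the copies (supports inside a fixed
    set). *)
Lemma sfaces_complex n (A : pred {set 'I_n}) :
  A finset.set0 -> (forall S T : {set 'I_n}, S \subset T -> A T -> A S) ->
  polytopal_complex (sfaces A).
Proof.
move=> A0 Asub; split.
- by apply: finite_image; exact: finite_finset.
- have s0 : supp [ffun _ : 'I_n => None] = finset.set0.
    by apply/setP => i; rewrite !inE ffunE.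
  by exists [ffun _ => None]; [rewrite /= s0 | exact: sface0].
- by move=> _ [s _ <-]; exact: sface_polytope.
- move=> _ F [s As <-] /sface_faceP [t ts ->].
  by exists t => //; exact: Asub ts As.
- move=> _ _ [s _ <-] [t _ <-]; have [u _ uE] := sface_capP s t.
  rewrite uE; split; apply: sface_sub_face; rewrite -uE.
    exact: subIsetl.
  exact: subIsetr.
Qed.

(** The face lies in the hyperplane s . x = 1, which misses the origin, so affinely independent
    points of it are linearly independent in the coordinate space of the support. The vertices
    attain the bound. *)
Lemma affdim_sface n (s : {ffun 'I_n -> option bool}) :
  affdim (sface s) = #|supp s|%:Z - 1.
Proof.
apply/le_anti/andP; split.
  apply: affdim_le => k p ap sp.
  pose M : 'M[R]_(k, #|supp s|) := \matrix_(i, j) p i 0 (enum_val j).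
  suff /eqP <- : row_free M by exact: rank_leq_col.
  apply: inj_row_free => v vM.
  have vp : \sum_i v 0 i *: p i = 0.
    apply/rowP => j; rewrite summxE mxE.
    case: (boolP (j \in supp s)) => js; last first.
      by rewrite big1 // => i _; rewrite mxE (sface_out (sp i) js) mulr0.
    move/rowP/(_ (enum_rank_in js j)): vM; rewrite !mxE => vM0; rewrite -[RHS]vM0.
    by apply: eq_bigr => i _; rewrite !mxE enum_rankK_in.
  (* Applying the functional s to the linear relation gives the coefficient sum, since s . p_i =
     1. *)
  have v1 : \sum_i v 0 i = 0.
    transitivity (dotv (signvec s) (\sum_i v 0 i *: p i)).
      rewrite dotv_sum; apply: eq_bigr => i _.
      by rewrite dotvZ; have /sfaceP[_ ->] := sp i; rewrite mulr1.
    by rewrite vp /dotv big1 // => i _; rewrite !mxE mulr0.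
  by apply/rowP => i; rewrite mxE; exact: (ap _ v1 vp).
pose p (i : 'I_#|supp s|) : 'rV[R]_n :=
  sgnr (s (enum_val i)) *: delta_mx 0 (enum_val i).
apply: (affdim_ge (p := p)) => [|a _ ap i|i].
- by rewrite ltnW // ltnS (leq_trans (max_card _)) ?card_ord.
- move/rowP/(_ (enum_val i)): ap; rewrite summxE mxE (bigD1 i) //= big1 => [|j ji].
    rewrite !mxE !eqxx mulr1 addr0 => /eqP.
    have := enum_valP i; rewrite inE => si.
    rewrite mulf_eq0 => /orP[/eqP //|].
    by rewrite -normr_eq0 normr_sgnr si oner_eq0.
  by rewrite !mxE (inj_eq enum_val_inj) eq_sym (negPf ji) andbF !mulr0.
- by apply: sface_vertex; exact: enum_valP.
Qed.

(** * Faces and skeleta of the cross-polytope *)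

Lemma cross_polytope_faceP n F : (0 < n)%N -> is_face F (cross_polytope R n) ->
  F = cross_polytope R n \/ exists s, F = sface s.
Proof.
move=> n0; rewrite cross_polytopeE // => -[c [b [cb ->]]].
have b0 : 0 <= b.
  have /cb : [set x | l1norm x <= 1] (0 : 'rV[R]_n).
    by rewrite /= /l1norm big1 // => i _; rewrite mxE normr0.
  by rewrite /dotv big1 // => i _; rewrite mxE mulr0.
have cle i : `|c 0 i| <= b.
  have h (e : bool) : (-1) ^+ e * c 0 i <= b.
    rewrite -dotv_delta -dotvZ; apply: cb.
    by rewrite /= l1normZ l1norm_delta normrX normrN1 expr1n mulr1.
  rewrite ler_norml lerNl; have := h true; rewrite expr1 mulN1r => ->.
  by have := h false; rewrite expr0 mul1r.
(* If b = 0 then c = 0, and the face is the whole polytope. *)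
have [bE|bn0] := eqVneq b 0.
  left; apply/seteqP; split=> x /= => [[]//|x1]; split=> //.
  rewrite bE /dotv big1 // => i _; move: (cle i).
  by rewrite bE normr_le0 => /eqP ->; rewrite mul0r.
(* A coordinate with |c_i| < b vanishes on the face; the others take the sign of c_i, [Some true]
   standing for -1. If no |c_i| reaches b, this is the empty face. *)
right; pose s := [ffun i => if `|c 0 i| == b then Some (c 0 i < 0) else None].
have key (x : 'rV[R]_n) i :
    x 0 i = sgnr (s i) * `|x 0 i| <-> c 0 i * x 0 i = b * `|x 0 i|.
  rewrite ffunE; case: eqP => [cbi|/eqP ne].
    have cE : c 0 i = b * sgnr (Some (c 0 i < 0)).
      by rewrite -cbi /= mulrC -realEsign ?num_real.
    rewrite [in X in _ <-> X]cE -mulrA sgnr_mul_eq.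
    by split=> [->|/(mulfI bn0)].
  rewrite mul0r; split=> [->|h]; first by rewrite normr0 !mulr0.
  apply/eqP; apply: contraT => x0.
  have : `|c 0 i| * `|x 0 i| < b * `|x 0 i|.
    by rewrite ltr_pM2r ?normr_gt0 // lt_neqAle ne cle.
  by rewrite -h -normrM ltNge ler_norm.
exists s; apply/seteqP; split=> x /=.
  move=> [x1 cx].
  have lei i : c 0 i * x 0 i <= b * `|x 0 i|.
    by apply: le_trans (ler_norm _) _; rewrite normrM ler_wpM2r.
  (* As b > 0, this puts x on the unit sphere, and then every inequality of [lei] is tight. *)
  have bl : b <= b * l1norm x.
    by rewrite -{1}cx /l1norm mulr_sumr; exact: ler_sum.
  have l1 : l1norm x = 1.
    apply/le_anti; rewrite x1 /=.
    by rewrite -(@ler_pM2l _ b) ?mulr1 // lt_neqAle eq_sym bn0.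
  split=> // i; apply/key; move: i; apply: eq_of_le_sum => //.
  by rewrite -mulr_sumr -/(l1norm x) l1 mulr1 -cx.
move=> [x1 sx]; rewrite x1 lexx; split=> //.
rewrite -[RHS]mulr1 -x1 /l1norm mulr_sumr; apply: eq_bigr => i _.
exact/key.
Qed.

(** The polytope itself has dimension at least n > l, and a sign face has one dimension less than
    its support has elements. *)
Lemma skeleton_cross_polytope n l : (l < n)%N ->
  skeleton (cross_polytope R n) l = sfaces (fun S : {set 'I_n} => #|S| <= l.+1)%N.
Proof.
move=> ln; have n0 : (0 < n)%N by case: n ln.
have dimE (s : {ffun 'I_n -> option bool}) :
    (affdim (sface s) <= l%:Z) = (#|supp s| <= l.+1)%N.
  by rewrite affdim_sface lerBlDr -PoszD addn1 lez_nat.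
apply/seteqP; split=> F.
  case=> /(cross_polytope_faceP n0) [->|[s ->]].
    move/(le_trans (affdim_cross_polytope n0)).
    by rewrite lez_nat leqNgt ln.
  by rewrite dimE => sl; exists s.
case=> s /= sl <-; split; last by rewrite dimE.
exists (signvec s), 1; rewrite cross_polytopeE //; split=> [x /= x1|].
  by apply: le_trans x1; apply: ler_sum => i _; rewrite mxE sgnr_mul_le.
by apply/seteqP; split=> x /= /sfaceP.
Qed.

Lemma sfaces_dim n l : (l < n)%N ->
  complex_dim (sfaces (fun S : {set 'I_n} => #|S| <= l.+1)%N) l.
Proof.
move=> ln; split.
  (* The simplex on the first l + 1 basis vectors, available since l < n, attains dimension l. *)
  pose s := [ffun i : 'I_n => if (i < l.+1)%N then Some false else None].
  have sl : #|supp s| = l.+1.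
    have -> : supp s = [set widen_ord ln i | i in 'I_l.+1]%SET.
      apply/setP => i; rewrite !inE ffunE; apply/idP/imsetP => [|[j _ ->]].
        by case: ifP => // il _; exists (Ordinal il) => //; exact: val_inj.
      by rewrite /= ltn_ord.
    rewrite card_imset ?card_ord // => i j /(congr1 val) /= ij; exact: val_inj.
  exists (sface s); first by exists s => //=; rewrite sl.
  by rewrite affdim_sface sl -addn1 PoszD addrK.
by move=> _ [s /= sl <-]; rewrite affdim_sface lerBlDr -PoszD addn1 lez_nat.
Qed.

(** * The copy attached to a set of coordinates *)

Lemma sfaces_iso n m (S : {set 'I_n}) : #|S| = m ->
  complex_isomorphic (sfaces (fun T : {set 'I_n} => T \subset S))
                     (sfaces (fun T : {set 'I_m} => #|T| <= m)%N).
Proof.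
(* With m replaced by [#|S|], [enum_val] identifies the coordinates of the small space with S. *)
move=> Sm; case: _ / Sm.
(* The isomorphism is the preimage under [emb]; it reflects inclusions because
   the faces supported on [S] lie in the range of [emb]. *)
pose emb (y : 'rV[R]_#|S|) : 'rV[R]_n := \sum_j y 0 j *: delta_mx 0 (enum_val j).
have embE y j : emb y 0 (enum_val j) = y 0 j.
  rewrite summxE (bigD1 j) //= big1 => [|k kj].
    by rewrite !mxE !eqxx mulr1 addr0.
  by rewrite !mxE (inj_eq enum_val_inj) eq_sym (negPf kj) andbF mulr0.
have emb_out y i : i \notin S -> emb y 0 i = 0.
  move=> iS; rewrite summxE big1 // => k _; rewrite !mxE.
  case: (eqVneq i (enum_val k)) => [ik|_]; last by rewrite andbF mulr0.
  by move: iS; rewrite ik enum_valP.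
have emb_l1 y : l1norm (emb y) = l1norm y.
  rewrite /l1norm (bigID (mem S)) /= [X in _ + X]big1 => [|i iS]; last first.
    by rewrite emb_out ?normr0.
  by rewrite addr0 big_enum_val; apply: eq_bigr => j _; rewrite embE.
have emb_surj s x : supp s \subset S -> sface s x ->
    x = emb (\row_j x 0 (enum_val j)).
  move=> /fintype.subsetP sS xs; apply/rowP => i; case: (boolP (i \in S)) => iS.
    by rewrite -(enum_rankK_in iS iS) embE mxE.
  by rewrite emb_out // (sface_out xs) //; apply: contra iS; exact: sS.
pose res (s : {ffun 'I_n -> option bool}) := [ffun j : 'I_#|S| => s (enum_val j)].
have preE s : supp s \subset S -> emb @^-1` sface s = sface (res s).
  move=> /fintype.subsetP sS; apply/seteqP; split=> y /= [y1 sy].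
    by split=> [|j]; rewrite -?emb_l1 // ffunE -embE.
  split=> [|i]; first by rewrite emb_l1.
  case: (boolP (i \in S)) => iS; last by rewrite emb_out // normr0 mulr0.
  rewrite -(enum_rankK_in iS iS) embE sy; congr (_ * _).
    by rewrite ffunE.
  by rewrite -sy.
have fsub F G : sfaces (fun T : {set 'I_n} => T \subset S) F ->
    (F `<=` G <-> emb @^-1` F `<=` emb @^-1` G).
  move=> [s /= sS <-]; split=> [FG y|FG x xs]; first exact: FG.
  by rewrite (emb_surj _ _ sS xs); apply: FG; rewrite /= -(emb_surj _ _ sS xs).
exists (fun F => emb @^-1` F); split; last by move=> F G FL _; exact: fsub.
split.
- move=> _ [s /= sS <-]; rewrite preE //; exists (res s) => //=.
  by rewrite (leq_trans (max_card _)) ?card_ord.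
- move=> F G; rewrite !in_setE => FL GL FG.
  by apply/seteqP; split; apply/fsub => //; rewrite FG.
- move=> _ [t _ <-].
  (* Extends t by [None] outside S; [insub] supplies the membership proof that [enum_rank_in]
     takes. *)
  pose s := [ffun i => if insub i : option {i | i \in S} is Some u
                       then t (enum_rank_in (valP u) i) else None].
  have sS : supp s \subset S.
    by apply/fintype.subsetP => i; rewrite inE ffunE; case: insubP.
  exists (sface s); first by exists s.
  rewrite preE //; congr (sface _); apply/ffunP => j; rewrite !ffunE.
  case: insubP => [u _ uj|]; last by rewrite enum_valP.
  congr (t _); apply: enum_val_inj; rewrite enum_rankK_in //; exact: enum_valP.
Qed.

End CrossPolytopeFaces.

(** * The factorization *)

Lemma card_superset (T : finType) (A : {set T}) k : (#|A| <= k <= #|T|)%N ->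
  exists2 B : {set T}, A \subset B & #|B| = k.
Proof.
case/andP=> Ak kT.
(* The missing k - [#|A|] elements are drawn from the complement of A; the binomial coefficient
   counting the draws is positive. *)
have : (0 < #|[set B : {set T} | B \subset ~: A & #|B| == (k - #|A|)%N]%SET|)%N.
  by rewrite cards_draws bin_gt0 leq_subLR cardsC.
case/card_gt0P => B; rewrite inE => /andP[BA /eqP Bk].
exists (A :|: B)%SET; first exact: finset.subsetUl.
rewrite cardsU disjoint_setI0 ?cards0 ?subn0 ?Bk ?subnKC //.
by rewrite disjoint_sym finset.disjoints_subset.
Qed.

Theorem theorem1 (R : realType) (l n : nat) (hl : (1 <= l)%N) (hln : (l < n)%N) :
  factors l (skeleton (cross_polytope R l.+1) l)
            (skeleton (cross_polytope R n) l).
Proof.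
have small m : polytopal_complex (sfaces (R := R) (fun S : {set 'I_m} => #|S| <= l.+1)%N).
  apply: sfaces_complex => [|S T ST]; first by rewrite cards0.
  exact: leq_trans (subset_leq_card ST).
rewrite !skeleton_cross_polytope //; split; [by []|by split; exact: sfaces_dim|].
pose D := [set S : {set 'I_n} | #|S| == l.+1]%SET.
have cardD (i : 'I_#|D|) : #|enum_val i| = l.+1.
  by have := enum_valP i; rewrite inE => /eqP.
exists #|D|, (fun i : 'I_#|D| => sfaces (fun T => T \subset enum_val i)).
split.
- move=> i; split=> [F [s /= sS <-]|].
    by exists s => //=; rewrite -(cardD i) subset_leq_card.
  apply: sfaces_complex => [|S T ST]; first exact: finset.sub0set.
  exact: fintype.subset_trans.
- by move=> i; apply: sfaces_iso; exact: cardD.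
- apply/seteqP; split=> F.
    case=> s /= sl <-.
    (* A support of fewer than l + 1 elements is enlarged, which is possible since l < n. *)
    have [|S sS Sl] := @card_superset _ (supp s) l.+1.
      by rewrite sl card_ord.
    have SD : S \in D by rewrite inE Sl.
    by exists (enum_rank_in SD S) => //; exists s => //=; rewrite enum_rankK_in.
  by case=> i _ [s /= sS <-]; exists s => //=; rewrite -(cardD i) subset_leq_card.
- move=> _ [s /= _ <-]; rewrite affdim_sface => /eqP.
  rewrite subr_eq -PoszD addn1 eqz_nat => /eqP sl.
  have sD : supp s \in D by rewrite inE sl.
  exists (enum_rank_in sD (supp s)); split.
    by exists s => //=; rewrite enum_rankK_in.
  (* Membership gives some t with the same face as s, so supports are compared through the faces;
     then two sets of size l + 1, one inside the other, coincide. *)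
  move=> i [t /= tS ts]; apply: enum_val_inj; rewrite enum_rankK_in //.
  apply/eqP; rewrite eqEcard sl cardD leqnn andbT.
  by apply: fintype.subset_trans tS; apply: (sface_sub_supp (R := R)); rewrite ts.
Qed.
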